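(* Let $n\in\mathbb{N}$ and let $i\in\mathbb{N}$ with $2\le i\le 2^n$. If $i\le 2^{n-1}$, then $\rho(\mathcal{L}_i^n,\mathcal{L}_{i+1}^n)=\infty$. If $i>2^{n-1}$, then $\rho(\mathcal{L}_i^n,\mathcal{L}_*^n)\le 4\operatorname{Flt}(n)$.
   Context: $\mathcal{C}^n$ is the family of all $n$-dimensional closed convex subsets of $\mathbb{R}^n$. A set $B\subseteq\mathbb{R}^n$ is lattice-free if $B\in\mathcal{C}^n$ and $\operatorname{int}(B)\cap\mathbb{Z}^n=\emptyset$. For $i\in\mathbb{N}$, $\mathcal{L}_i^n$ is the family of all lattice-free polyhedra in $\mathbb{R}^n$ with at most $i$ facets, and $\mathcal{L}_*^n$ is the family of all lattice-free polyhedra in $\mathbb{R}^n$. For $B\in\mathcal{C}^n$ with $0\in\operatorname{int}(B)$, the gauge function is $\psi_B(r)=\inf\{\lambda>0: r\in\lambda B\}$. For $k\in\mathbb{N}$, $R=(r_1,\dots,r_k)\in\mathbb{R}^{n\times k}$, $f\in\mathbb{R}^n\setminus\mathbb{Z}^n$ and $B\in\mathcal{C}^n$: if $f\in\operatorname{int}(B)$, $C_B(R,f)=\{s\in\mathbb{R}^k_{\ge0}:\sum_{j=1}^k s_j\psi_{B-f}(r_j)\ge1\}$; otherwise $C_B(R,f)=\mathbb{R}^k_{\ge0}$. For a family $\mathcal{B}\subseteq\mathcal{C}^n$, $C_{\mathcal{B}}(R,f)=\bigcap_{B\in\mathcal{B}}C_B(R,f)$ (equal to $\mathbb{R}^k_{\ge0}$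 if $\mathcal{B}=\emptyset$). For families $\mathcal{B},\mathcal{L}\subseteq\mathcal{C}^n$ and $f\in\mathbb{R}^n\setminus\mathbb{Z}^n$, $\rho_f(\mathcal{B},\mathcal{L})=\inf\{\alpha>0: C_{\mathcal{B}}(R,f)\subseteq\frac1\alpha C_{\mathcal{L}}(R,f)$ for all $k\in\mathbb{N}$ and all $R\in\mathbb{R}^{n\times k}\}$, and $\rho(\mathcal{B},\mathcal{L})=\sup\{\rho_f(\mathcal{B},\mathcal{L}):f\in\mathbb{R}^n\setminus\mathbb{Z}^n\}$. The lattice width of a nonempty $X\subseteq\mathbb{R}^n$ is $w(X)=\inf_{u\in\mathbb{Z}^n\setminus\{0\}}(\sup_{x\in X}u\cdot x-\inf_{x\in X}u\cdot x)$, and the flatness constant is $\operatorname{Flt}(n)=\sup\{w(B): B \text{ lattice-free in } \mathbb{R}^n\}$ (which is finite). *)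

(* Defs.v *)
From HB Require Import structures.
From mathcomp Require Import all_boot all_order all_algebra.
From mathcomp Require Import all_classical all_reals all_analysis.
Set Implicit Arguments.
Unset Strict Implicit.
Unset Printing Implicit Defensive.
Import Order.TTheory GRing.Theory Num.Theory.
Import numFieldNormedType.Exports.
Local Open Scope classical_set_scope.
Local Open Scope ring_scope.

Section Defs.
Variable R : realType.

Definition dotv (n : nat) (u x : 'rV[R]_n) : R := \sum_(j < n) u 0 j * x 0 j.

Definition lattice_pt (n : nat) (x : 'rV[R]_n) : Prop :=
  forall j, x 0 j \is a Num.int.

Definition convexR (n : nat) (B : set 'rV[R]_n) : Prop :=
  forall x y (t : R), B x -> B y -> 0 <= t -> t <= 1 ->
    B ((1 - t) *: x + t *: y).

(* C^n : closed convex n-dimensional (= nonempty interior) subsets of R^n *)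
Definition in_Cn (n : nat) (B : set 'rV[R]_n) : Prop :=
  closed B /\ convexR B /\ exists x, (B°) x.

Definition lattice_free (n : nat) (B : set 'rV[R]_n) : Prop :=
  in_Cn B /\ forall x, (B°) x -> ~ lattice_pt x.

(* polyhedron described by (at most) i closed halfspaces; for a full-dimensional
   polyhedron this is equivalent to having at most i facets *)
Definition poly_at_most (n i : nat) (B : set 'rV[R]_n) : Prop :=
  exists (a : 'I_i -> 'rV[R]_n) (b : 'I_i -> R),
    B = [set x | forall j, dotv (a j) x <= b j].

Definition Lfam (n i : nat) : set (set 'rV[R]_n) :=
  [set B | lattice_free B /\ poly_at_most i B].

Definition Lstar (n : nat) : set (set 'rV[R]_n) :=
  [set B | lattice_free B /\ exists i, poly_at_most i B].

Definition scale_set (m : nat) (l : R) (B : set 'rV[R]_m) : set 'rV[R]_m :=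
  [set l *: x | x in B].

Definition translate (n : nat) (B : set 'rV[R]_n) (f : 'rV[R]_n) : set 'rV[R]_n :=
  [set x - f | x in B].

Definition gauge (n : nat) (B : set 'rV[R]_n) (r : 'rV[R]_n) : R :=
  inf [set l : R | 0 < l /\ scale_set l B r].

(* C_B(R,f); the matrix R = (r_1,...,r_k) is given by its columns r *)
Definition CB (n k : nat) (r : 'I_k -> 'rV[R]_n) (f : 'rV[R]_n)
    (B : set 'rV[R]_n) : set 'rV[R]_k :=
  if `[< (B°) f >] then
    [set s | (forall j, 0 <= s 0 j) /\
             1 <= \sum_(j < k) s 0 j * gauge (translate B f) (r j)]
  else [set s | forall j, 0 <= s 0 j].

Definition CFam (n k : nat) (r : 'I_k -> 'rV[R]_n) (f : 'rV[R]_n)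
    (F : set (set 'rV[R]_n)) : set 'rV[R]_k :=
  [set s | forall B, F B -> CB r f B s].

Definition rho_f (n : nat) (F L : set (set 'rV[R]_n)) (f : 'rV[R]_n) : \bar R :=
  ereal_inf [set a%:E | a in [set a : R | 0 < a /\
     forall (k : nat) (r : 'I_k -> 'rV[R]_n), (0 < k)%N ->
       CFam r f F `<=` scale_set a^-1 (CFam r f L)]].

Definition rho (n : nat) (F L : set (set 'rV[R]_n)) : \bar R :=
  ereal_sup [set rho_f F L f | f in [set f : 'rV[R]_n | ~ lattice_pt f]].

Definition lattice_width (n : nat) (X : set 'rV[R]_n) : \bar R :=
  ereal_inf [set (ereal_sup [set (dotv u x)%:E | x in X]
                  - ereal_inf [set (dotv u x)%:E | x in X])%E
            | u in [set u : 'rV[R]_n | lattice_pt u /\ u != 0]].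

Definition Flt (n : nat) : \bar R :=
  ereal_sup [set lattice_width B | B in [set B : set 'rV[R]_n | lattice_free B]].

End Defs.

(* Main.v *)
Require Import Defs.
From HB Require Import structures.
From mathcomp Require Import all_boot all_order all_algebra.
From mathcomp Require Import all_classical all_reals all_analysis.
From mathcomp Require Import zify ring lra.
Import Order.TTheory GRing.Theory Num.Theory.
Import numFieldNormedType.Exports.
Local Open Scope classical_set_scope.
Local Open Scope ring_scope.

(* Upper bound.  Let [alpha > 4 Flt], let [L] be lattice-free and let [K] be the
   copy of [L] shrunk by [alpha] towards [f].  Some integer direction [u], which
   may be taken not divisible by 2, has width less than [1/4] on [K].  If [K] lies
   strictly between two consecutive levels of [u], a split covers it.  Otherwise
   [K] is within [1/4] of one level, and by a parity argument [2 ^ (n - 1)] of the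
   inequalities of [L] already exclude the lattice points of that level.  Either
   these confine one side of the level, or they can be tilted so as to shrink
   quickly on that side; one further halfspace on the other side then gives a
   lattice-free polyhedron containing [K].

   Lower bound.  Partition the cube [{0,1}^(n-1)] into [i] subcubes; each gives a
   facet of a lattice-free polyhedron in the level 0 touching the lattice at a
   vertex of that subcube only.  Let [L] be the pyramid over it with a very low
   apex, truncated at the level [-1], and let [f] be just below the apex.  The [i]
   contact points and one lattice point of level [-1] are [i + 1] points, so a
   lattice-free set with [i] facets has two of them beyond the same facet, together
   with the segment joining them.  But each such segment contains a point whose
   position relative to [f] can be dilated by an arbitrarily large factor inside
   [L]. *)

Set Implicit Arguments.
Unset Strict Implicit.
Unset Printing Implicit Defensive.

(** * Polyhedra *)

Section Polyhedra.
Variables (R : realType) (n : nat).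
Implicit Types (u x y f d : 'rV[R]_n) (B : set 'rV[R]_n).

Lemma dotvDr u x y : dotv u (x + y) = dotv u x + dotv u y.
Proof. by rewrite -big_split; apply: eq_bigr => j _; rewrite mxE mulrDr. Qed.

Lemma dotvZr u (t : R) x : dotv u (t *: x) = t * dotv u x.
Proof. by rewrite mulr_sumr; apply: eq_bigr => j _; rewrite mxE mulrCA. Qed.

Lemma dotvC u x : dotv u x = dotv x u.
Proof. by apply: eq_bigr => j _; rewrite mulrC. Qed.

Lemma dotvNr u x : dotv u (- x) = - dotv u x.
Proof. by rewrite -scaleN1r dotvZr mulN1r. Qed.

Lemma dotvBr u x y : dotv u (x - y) = dotv u x - dotv u y.
Proof. by rewrite dotvDr dotvNr. Qed.

Lemma dotvDl u x y : dotv (u + x) y = dotv u y + dotv x y.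
Proof. by rewrite !(dotvC _ y) dotvDr. Qed.

Lemma dotvZl (t : R) u y : dotv (t *: u) y = t * dotv u y.
Proof. by rewrite !(dotvC _ y) dotvZr. Qed.

Lemma dotvNl u y : dotv (- u) y = - dotv u y.
Proof. by rewrite !(dotvC _ y) dotvNr. Qed.

Lemma dotv0l y : dotv 0 y = 0.
Proof. by rewrite -(scale0r 0) dotvZl mul0r. Qed.

Lemma dotv_sumr u (I : Type) (s : seq I) (F : I -> 'rV[R]_n) :
  dotv u (\sum_(i <- s) F i) = \sum_(i <- s) dotv u (F i).
Proof.
elim: s => [|i s ih]; first by rewrite !big_nil dotvC dotv0l.
by rewrite !big_cons dotvDr ih.
Qed.

Lemma dotv_delta u (k : 'I_n) : dotv u (delta_mx 0 k) = u 0 k.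
Proof.
rewrite /dotv (bigD1 k) //= big1 ?addr0 => [|j jk]; rewrite mxE eqxx /=.
  by rewrite eqxx mulr1.
by rewrite (negbTE jk) mulr0.
Qed.

Lemma dotv_continuous u : continuous (dotv u).
Proof.
have H s : continuous (fun x : 'rV[R]_n => \sum_(j <- s) u 0 j * x 0 j).
  elim: s => [|j s ih] x.
    by under eq_fun do rewrite big_nil; exact: cst_continuous.
  under eq_fun do rewrite big_cons.
  apply: continuousD (ih x); apply: (@cvgMl_tmp _ _ (nbhs x)); exact: coord_continuous.
exact: H.
Qed.

Lemma interior_ray B x d : B° x -> exists2 t : R, 0 < t & B (x + t *: d).
Proof.
move=> /nbhs_ballP[e /= e0 eB].
have nd : 0 < 2 * (1 + `|d|) by rewrite mulr_gt0// ltr_pwDl.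
exists (e / (2 * (1 + `|d|))); first by rewrite divr_gt0.
apply: eB; rewrite -ball_normE /ball_ /= opprD addNKr normrN normrZ.
rewrite gtr0_norm ?divr_gt0// mulrAC ltr_pdivrMr// ltr_pM2l//.
by have := normr_ge0 d; lra.
Qed.

Section System.
Variables (m : nat) (a : 'I_m -> 'rV[R]_n) (b : 'I_m -> R).
Let P := [set x | forall j, dotv (a j) x <= b j].

Lemma closed_system : closed P.
Proof.
have -> : P = \bigcap_(j in [set: 'I_m]) (dotv (a j) @^-1` [set t | t <= b j]).
  by apply/seteqP; split=> x /= H j; [move=> _|]; apply: H.
apply: closed_bigI => j _; apply: preimage_closed (@closed_le _ _).
by move=> x _; exact: dotv_continuous.
Qed.

Lemma convex_system : convexR P.
Proof.
move=> x y t Px Py t0 t1 j; rewrite dotvDr !dotvZr.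
by have := Px j; have := Py j; nra.
Qed.

Lemma strict_interior x : (forall j, dotv (a j) x < b j) -> P° x.
Proof.
move=> H; rewrite /interior; have FF := @nbhs_filter _ x.
have : \forall y \near x, forall j, dotv (a j) y < b j.
  apply: (@filter_forall _ _ (fun j y => dotv (a j) y < b j) (nbhs x)) => j.
  have cj := @dotv_continuous (a j) x.
  exact: (cj _ (open_nbhs_nbhs (conj (@open_lt _ (b j)) (H j)))).
by apply: filterS => y Hy j; exact: ltW.
Qed.

End System.

(* Moving from [x] away from [f] would leave the halfspace if it were tight at
   [x]; the strict point [f] rules out the degenerate normal vector [0]. *)
Lemma interior_strict B a (b : R) f x :
  (forall y, B y -> dotv a y <= b) -> dotv a f < b -> B° x -> dotv a x < b.
Proof.
move=> aB af Bx; have [t t0 Bt] := interior_ray (x - f) Bx.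
have := aB _ Bt; rewrite dotvDr dotvZr dotvBr; nra.
Qed.

(** A zero normal may come with the bound 0, which is strict nowhere; its bound becomes 1. For a
    nonzero normal, [B] contains a point reached from [f] along it, so the inequality has slack at
    [f]. *)
Lemma poly_strict i B f : poly_at_most i B -> B° f ->
  exists (a : 'I_i -> 'rV[R]_n) (b : 'I_i -> R),
    B = [set x | forall j, dotv (a j) x <= b j] /\ forall j, dotv (a j) f < b j.
Proof.
move=> [a [b BE]] Bf.
have Bf0 : B f by apply: interior_subset.
pose b' j := if a j == 0 then 1 else b j.
have b0 j : a j = 0 -> 0 <= b j.
  by move=> a0; move: Bf0; rewrite BE => /(_ j); rewrite a0 dotv0l.
exists a, b'; split.
  rewrite BE; apply/seteqP; split=> x /= H j; have := H j; rewrite /b';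
    case: eqP => // a0; rewrite a0 dotv0l// => _; exact: b0.
move=> j; rewrite /b'; case: eqP => [->|/eqP a0]; first by rewrite dotv0l.
have [t t0 Bt] := interior_ray (a j) Bf.
have aa : 0 < dotv (a j) (a j).
  rewrite lt_def sumr_ge0 ?andbT => [|k _]; last by rewrite -expr2 sqr_ge0.
  apply: contra a0; rewrite psumr_eq0 => [/allP H|k _]; last first.
    by rewrite -expr2 sqr_ge0.
  apply/eqP/rowP => k; have := H k (mem_index_enum _).
  by rewrite mulf_eq0 orbb mxE => /eqP.
by move: Bt; rewrite BE => /(_ j); rewrite dotvDr dotvZr; nra.
Qed.

Lemma poly_at_mostW i k B : (i <= k)%N -> poly_at_most i B -> poly_at_most k B.
Proof.
move=> ik [a [b ->]].
(* The surplus inequalities read [0 <= 0]. *)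
exists (fun j : 'I_k => if insub (j : nat) is Some j' then a j' else 0).
exists (fun j : 'I_k => if insub (j : nat) is Some j' then b j' else 0).
apply/seteqP; split=> x /= H j.
  by case: insubP => [j' _ _|_]; rewrite ?dotv0l.
by have := H (widen_ord ik j); rewrite insubT//= => ji; rewrite (_ : Sub _ _ = j)//; apply: val_inj.
Qed.

Definition intv (v : 'rV[int]_n) : 'rV[R]_n := map_mx intr v.

Lemma lattice_ptP x : lattice_pt x <-> exists v, x = intv v.
Proof.
split=> [xl|[v ->] j]; last by rewrite mxE intr_int.
exists (\row_j Num.floor (x 0 j)); apply/rowP => j.
by rewrite !mxE (floorK (xl j)).
Qed.

Lemma system_Lfam i m (a : 'I_m -> 'rV[R]_n) (b : 'I_m -> R) f :
  (m <= i)%N -> (forall j, dotv (a j) f < b j) ->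
  (forall v, exists j, b j <= dotv (a j) (intv v)) ->
  Lfam i [set x | forall j, dotv (a j) x <= b j].
Proof.
move=> mi af av; split; last by apply: poly_at_mostW mi _; exists a, b.
split.
  split; first exact: closed_system.
  split; first exact: convex_system.
  by exists f; exact: strict_interior.
move=> x Bx /lattice_ptP[v xE]; have [j] := av v.
rewrite -xE leNgt => /negP; apply.
by apply: interior_strict (af j) Bx => y; apply.
Qed.

Lemma lattice_free_system m (a : 'I_m -> 'rV[R]_n) (b : 'I_m -> R) v :
  lattice_free [set x | forall j, dotv (a j) x <= b j] ->
  exists j, b j <= dotv (a j) (intv v).
Proof.
move=> [_ H]; apply/not_existsP => nv; apply: (H (intv v)); last first.
  by apply/lattice_ptP; exists v.
by apply: strict_interior => j; rewrite ltNge; apply/negP/nv.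
Qed.

End Polyhedra.

(** * A Doignon-Bell-Scarf theorem for integer hyperplanes *)

Lemma seq_argmin (R : realType) (X : eqType) (h : X -> R) (s : seq X) x0 :
  x0 \in s -> exists2 x, x \in s & forall y, y \in s -> h x <= h y.
Proof.
elim: s x0 => // z s ih x0 _; case: s ih => [_|z' s ih].
  by exists z => [|y]; rewrite !inE // => /eqP->.
have [x xs xm] := ih z' (mem_head _ _).
have [zx|xz] := leP (h z) (h x).
  exists z => [|y]; first exact: mem_head.
  by rewrite in_cons => /predU1P[->//|/xm]; exact: le_trans.
exists x => [|y]; first by rewrite in_cons xs orbT.
by rewrite in_cons => /predU1P[->|/xm//]; exact: ltW.
Qed.

(* In an irredundant infeasible finite system, each right-hand side can be raised
   in turn until it becomes tight at some point satisfying all other inequalities. *)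
Lemma tighten_system (R : realType) (X : eqType) (s : seq X) (m : nat)
    (g : 'I_m -> X -> R) (c : 'I_m -> R) :
  (forall x, x \in s -> exists j, c j <= g j x) ->
  (forall j, exists2 x, x \in s & forall i, i != j -> g i x < c i) ->
  exists c' : 'I_m -> R, (forall x, x \in s -> exists j, c' j <= g j x) /\
    forall j : 'I_m, exists2 x, x \in s & g j x = c' j /\ forall i, i != j -> g i x < c' i.
Proof.
move=> inf wit.
suff H k : (k <= m)%N -> exists c' : 'I_m -> R,
    (forall x, x \in s -> exists j, c' j <= g j x) /\
    forall j : 'I_m, exists2 x, x \in s & ((j < k)%N -> g j x = c' j) /\
      forall i, i != j -> g i x < c' i.
  have [c' [? H']] := H m (leqnn m); exists c'; split=> // j.
  by have [x xs [gx ?]] := H' j; exists x => //; split=> //; apply: gx.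
elim: k => [_|k ih km].
  by exists c; split=> // j; have [x xs ?] := wit j; exists x.
have [c' [inf' wit']] := ih (ltnW km); pose j := Ordinal km.
(* These points are excluded by inequality [j] alone; the minimum of [g j] over them becomes the new
   right-hand side. *)
pose s' := [seq x <- s | [forall i, (i != j) ==> (g i x < c' i)]].
have s'P x : reflect (x \in s /\ forall i, i != j -> g i x < c' i) (x \in s').
  rewrite mem_filter andbC; apply: (iffP andP) => -[-> /=].
    by move=> /forallP H; split=> // i; apply/implyP.
  by move=> H; split=> //; apply/forallP => i; apply/implyP/H.
have [x0 /s'P[x0s x0c] x0m] : exists2 x, x \in s' & forall y, y \in s' -> g j x <= g j y.
  by have [x xs [_ xc]] := wit' j; apply: (@seq_argmin _ _ _ _ x); apply/s'P.
have c'x0 : c' j <= g j x0.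
  have [i ci] := inf' _ x0s; have [<-//|ij] := eqVneq i j.
  by have := x0c i ij; rewrite ltNge ci.
pose c2 i := if i == j then g j x0 else c' i.
have c'c2 i : c' i <= c2 i by rewrite /c2; case: eqP => // ->.
exists c2; split=> [x xs|l].
  have [/x0m xm|/s'P xs'] := boolP (x \in s').
    by exists j; rewrite /c2 eqxx.
  have : exists i, i != j /\ c' i <= g i x.
    apply/not_existsP => H; apply: xs'; split=> // i ij.
    by rewrite ltNge; apply/negP => ci; apply: (H i).
  by case=> i [ij ci]; exists i; rewrite /c2 (negbTE ij).
have [->|lj] := eqVneq l j.
  exists x0 => //; rewrite /c2 eqxx; split=> // i ij.
  by rewrite (negbTE ij) x0c.
have [x xs [gx xc]] := wit' l; exists x => //; split=> [lk|i il].
  rewrite /c2 (negbTE lj) gx//; move: lk; rewrite ltnS leq_eqVlt => /predU1P[lk|//].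
  by case/eqP: lj; apply: val_inj.
exact: lt_le_trans (xc _ il) _.
Qed.

Section IntegerHyperplane.
Variable n : nat.
Implicit Types u v w : 'rV[int]_n.

Definition idot u v : int := \sum_k u 0 k * v 0 k.

Lemma dotv_intv (R : realType) u v :
  dotv (intv R u) (intv R v) = (idot u v)%:~R.
Proof. by rewrite rmorph_sum; apply: eq_bigr => k _; rewrite !mxE rmorphM. Qed.

Lemma idotDr u v w : idot u (v + w) = idot u v + idot u w.
Proof. by rewrite -big_split; apply: eq_bigr => k _; rewrite mxE mulrDr. Qed.

(** Tightening a system needs finitely many points. A shift by [N] indexes the box by ordinals. *)
Lemma box_seq (N : nat) : exists s : seq 'rV[int]_n,
  forall v, (v \in s) <-> forall k, (absz (v 0%R k) <= N)%N.
Proof.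
pose F (M : 'rV['I_(N.*2.+1)]_n) : 'rV[int]_n := map_mx (fun i : 'I_(N.*2.+1) => (i : nat)%:Z - N%:Z) M.
exists [seq F M | M <- enum {: 'rV['I_(N.*2.+1)]_n}] => v; split.
  by move=> /mapP[M _ ->] k; rewrite mxE; case: (M 0 k) => i /= iN; lia.
move=> vN; apply/mapP.
exists (\row_k inord (absz (v 0 k + N%:Z))); first by rewrite mem_enum.
by apply/rowP => k; rewrite !mxE inordK; have := vN k; move: (v 0 k) => t; lia.
Qed.

Lemma intv_half (R : realType) v w : (forall k, (2 %| v 0%R k - w 0%R k)%Z) ->
  exists z : 'rV[int]_n, [/\ forall k, v 0 k + w 0 k = z 0 k *+ 2,
                intv R z = 2^-1 *: (intv R v + intv R w) &
                forall u, idot u v + idot u w = idot u z *+ 2].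
Proof.
move=> vw; exists (\row_k ((v 0%R k + w 0%R k) %/ 2)%Z).
have zE k : v 0 k + w 0 k = (\row_k ((v 0%R k + w 0%R k) %/ 2)%Z : 'rV[int]_n) 0 k *+ 2.
  by rewrite mxE; have := vw k; lia.
split=> // [|u].
  apply/rowP => k; have := congr1 (fun t : int => t%:~R : R) (zE k).
  by rewrite !mxE rmorphD /= rmorphMn /=; lra.
rewrite -idotDr mulr2n -idotDr; congr idot; by apply/rowP => k; rewrite mxE zE mulr2n !mxE.
Qed.

End IntegerHyperplane.

(** In the vanishing sum for [u] against [v - w], all terms off [k0] are even; hence so is the term
    at [k0], whose factor [u 0 k0] is odd. *)
Lemma idot_parity n (u v w : 'rV[int]_n) (k0 : 'I_n) :
  ~~ (2 %| u 0%R k0)%Z -> idot u v = idot u w ->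
  (forall k, k != k0 -> (2 %| v 0%R k - w 0%R k)%Z) -> (2 %| v 0%R k0 - w 0%R k0)%Z.
Proof.
move=> uk0 uvw vw.
have : (2 %| \sum_k u 0%R k * (v 0%R k - w 0%R k))%Z.
  have -> : \sum_k u 0 k * (v 0 k - w 0 k) = idot u v - idot u w.
    by rewrite -sumrB; apply: eq_bigr => k _; rewrite mulrBr.
  by rewrite uvw subrr dvdz0.
rewrite (bigD1 k0)//= rpredDr; last first.
  by apply: rpred_sum => k kk0; rewrite dvdz_mull// vw.
by rewrite -[_ \in _]/(2 %| _)%Z !dvdzE abszM Euclid_dvdM// -!dvdzE (negbTE uk0).
Qed.

(* A variant of the Doignon-Bell-Scarf theorem: two congruent witnesses of
   irredundance would have an integral midpoint. Parity off the odd coordinate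
   [k0] determines parity at [k0], which leaves [2 ^ n] classes. *)
Lemma doignon_drop (R : realType) n (u : 'rV[int]_n.+1) (k0 : 'I_n.+1) (c : int)
    p (a : 'I_p.+1 -> 'rV[R]_n.+1) (b : 'I_p.+1 -> R) :
  ~~ (2 %| u 0%R k0)%Z -> (2 ^ n < p.+1)%N ->
  (forall v, idot u v = c -> exists j, b j <= dotv (a j) (intv R v)) ->
  exists j0, forall v, idot u v = c ->
    exists j, b (lift j0 j) <= dotv (a (lift j0 j)) (intv R v).
Proof.
move=> uk0 np inf; apply/not_existsP => nj.
have /choice[z zP] : forall j0, exists v, idot u v = c /\
    forall j, j != j0 -> dotv (a j) (intv R v) < b j.
  move=> j0; have /existsNP[v /not_implyP[uv /forallNP H]] := nj j0.
  exists v; split=> // j.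
  rewrite eq_sym => /unlift_some[j' -> _].
  by rewrite ltNge; apply/negP/H.
(* The box of radius [N] contains all witnesses and is closed under integral midpoints, so it can
   replace the whole lattice. *)
pose N := (\sum_j \sum_k absz (z j 0%R k))%N.
have zN j k : (absz (z j 0%R k) <= N)%N.
  by rewrite /N (bigD1 j)//= (bigD1 k)//= -addnA leq_addr.
have [s sP] := @box_seq n.+1 N.
pose s' := [seq v <- s | idot u v == c].
have s'P v : (v \in s') <-> idot u v = c /\ forall k, (absz (v 0%R k) <= N)%N.
  by rewrite mem_filter; split=> [/andP[/eqP ? /sP]|[/eqP -> /sP]].
have [|j|b' [inf' wit']] := @tighten_system R _ s' p.+1 (fun j v => dotv (a j) (intv R v)) b.
- by move=> v /s'P[/inf].
- by have [? ?] := zP j; exists (z j) => //; apply/s'P.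
have /choice[y yP] : forall j, exists x, x \in s' /\ dotv (a j) (intv R x) = b' j /\
    forall i, i != j -> dotv (a i) (intv R x) < b' i.
  by move=> j; have [x ? ?] := wit' j; exists x.
have y1 j := (yP j).1; have y2 j := (yP j).2.
pose key j := [ffun k => (2 %| y j 0%R (lift k0 k))%Z] : {ffun 'I_n -> bool}.
have [j [l jl kjl]] : exists j, exists2 l, j != l & key j = key l.
  apply/injectivePn/negP => /injectiveP /leq_card.
  by rewrite card_ord card_ffun card_bool card_ord leqNgt np.
have [yj yjN] := (s'P _).1 (y1 j); have [yl ylN] := (s'P _).1 (y1 l).
have vw k : k != k0 -> (2 %| y j 0%R k - y l 0%R k)%Z.
  rewrite eq_sym => /unlift_some[k' -> _].
  by have := congr1 (fun F : {ffun _} => F k') kjl; rewrite !ffunE; lia.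
have [|w [wE wR wI]] := @intv_half _ R (y j) (y l).
  move=> k; have [->|/vw//] := eqVneq k k0.
  by apply: (idot_parity uk0) => //; rewrite yj yl.
have ws : w \in s'.
  apply/s'P; split=> [|k]; first by have := wI u; rewrite yj yl; lia.
  by move: (wE k) (yjN k) (ylN k); rewrite mulr2n; move: (y j 0 k) (y l 0 k) (w 0 k); lia.
have [i] := inf' _ ws; rewrite wR dotvZr dotvDr.
have [ej lj] := y2 j; have [el ll] := y2 l.
(* Each inequality is strict at [y j] or at [y l] and at worst tight at the other, hence strict at
   the midpoint [w]. *)
have [ij|ij] := eqVneq i j.
  by have := ll i; rewrite ij jl => /(_ isT); move: ej; lra.
have [il|il] := eqVneq i l.
  by have := lj i; rewrite ij => /(_ isT); rewrite il; move: el; lra.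
by have := ll i il; have := lj i ij; lra.
Qed.

Lemma doignon (R : realType) n (u : 'rV[int]_n.+1) (k0 : 'I_n.+1) (c : int)
    p (a : 'I_p -> 'rV[R]_n.+1) (b : 'I_p -> R) :
  ~~ (2 %| u 0%R k0)%Z ->
  (forall v, idot u v = c -> exists j, b j <= dotv (a j) (intv R v)) ->
  exists q (s : 'I_q -> 'I_p), (q <= 2 ^ n)%N /\
    forall v, idot u v = c -> exists j, b (s j) <= dotv (a (s j)) (intv R v).
Proof.
move=> uk0; elim: p a b => [|p ih] a b inf; first by exists 0, id.
have [np|pn] := ltnP (2 ^ n) p.+1; last by exists p.+1, id.
have [j0 inf0] := doignon_drop uk0 np inf.
have [q [s [qn H]]] := ih _ _ inf0.
by exists q, (fun j => lift j0 (s j)).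
Qed.

(** * The upper bound *)

Lemma finite_sup_lt (R : realType) m (x : 'I_m -> R) (c : R) :
  (forall j, x j < c) -> exists2 t, t < c & forall j, x j <= t.
Proof.
move=> xc; exists (\big[Num.max/(c - 1)]_j x j); last by move=> j; exact: le_bigmax.
by apply/bigmax_ltP; split=> // ; rewrite ltrBlDr ltrDl.
Qed.

Lemma finite_bound (R : realType) m (x : 'I_m -> R) : exists t, forall j, x j <= t.
Proof.
by exists (\big[Num.max/0]_j x j) => j; exact: le_bigmax.
Qed.

(* One-dimensional Hahn-Banach: the sublinear function
   [d |-> max_j dotv (a j) d / beta j] is nonnegative on the kernel of [dotv u],
   hence bounded below by a multiple of [dotv u]. *)
Lemma exists_slope (R : realType) n m (u d0 : 'rV[R]_n) (a : 'I_m -> 'rV[R]_n)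
    (beta : 'I_m -> R) :
  dotv u d0 = 1 -> (forall j, 0 < beta j) ->
  (forall d, dotv u d = 0 -> exists j, 0 <= dotv (a j) d) ->
  exists kappa, forall d, exists j, kappa * beta j * dotv u d <= dotv (a j) d.
Proof.
move=> ud0 b0 ker.
(* [inf S] is the infimum of the sublinear function over the level 1 of [dotv u]; it serves as
   [kappa]. *)
pose S := [set t : R | exists d, dotv u d = 1 /\ forall j, dotv (a j) d <= t * beta j].
have bnd d : exists t, forall j, dotv (a j) d <= t * beta j.
  have [t tP] := finite_bound (fun j => dotv (a j) d / beta j).
  by exists t => j; rewrite -ler_pdivrMr.
have slack d c : (forall j, dotv (a j) d < c * beta j) ->
    exists2 t, t < c & forall j, dotv (a j) d <= t * beta j.
  move=> H; have [|t tc tP] := @finite_sup_lt R m (fun j => dotv (a j) d / beta j) c.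
    by move=> j; rewrite ltr_pdivrMr.
  by exists t => // j; rewrite -ler_pdivrMr.
have S0 : S !=set0 by have [t tP] := bnd d0; exists t, d0.
have lS : has_lbound S.
  have [t0 t0P] := bnd (- d0); exists (- t0) => t [d [ud dt]].
  have [|j] := ker (d - d0); first by rewrite dotvBr ud ud0 subrr.
  by rewrite dotvDr; have := t0P j; have := dt j; have := b0 j; nra.
have pos d : dotv u d = 1 -> exists j, inf S * beta j <= dotv (a j) d.
  move=> ud; apply/not_existsP => H.
  have [j|t tS tP] := slack d (inf S); first by rewrite ltNge; apply/negP/H.
  by have : inf S <= t; [apply: ge_inf => //; exists d | rewrite leNgt tS].
have neg d : dotv u d = -1 -> exists j, - inf S * beta j <= dotv (a j) d.
  move=> ud; apply/not_existsP => H.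
  have [j|t tS tP] := slack d (- inf S); first by rewrite ltNge; apply/negP/H.
  have e0 : 0 < - t - inf S by lra.
  (* Here [s < - t], so the kernel vector [d + d1] makes every [dotv (a j)] negative. *)
  have [s [d1 [ud1 d1P]] st] := inf_adherent e0 (conj S0 lS).
  have [|j] := ker (d + d1); first by rewrite dotvDr ud ud1; lra.
  by rewrite dotvDr; have := tP j; have := d1P j; have := b0 j; nra.
exists (inf S) => d; have [ud|ud|ud] := ltgtP (dotv u d) 0.
- have [|j] := neg ((- dotv u d)^-1 *: d).
    by rewrite dotvZr invrN mulNr mulVf// lt_eqF.
  rewrite dotvZr [_^-1 * _]mulrC ler_pdivlMr ?oppr_gt0// => H; exists j; nra.
- have [|j] := pos ((dotv u d)^-1 *: d).
    by rewrite dotvZr mulVf// gt_eqF.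
  by rewrite dotvZr [_^-1 * _]mulrC ler_pdivlMr// => H; exists j.
- by have [j] := ker _ ud; exists j; rewrite ud mulr0.
Qed.

Lemma intvD (R : realType) n (v w : 'rV[int]_n) : intv R (v + w) = intv R v + intv R w.
Proof. by apply/rowP => k; rewrite !mxE rmorphD. Qed.

(** Far along [d] all inequalities hold with large slack, while rounding to a lattice point of the
    same level costs a bounded amount. *)
Lemma hyperplane_rounding (R : realType) n m (u z : 'rV[int]_n) (k0 : 'I_n)
    (a : 'I_m -> 'rV[R]_n) (b : 'I_m -> R) (d : 'rV[R]_n) :
  u 0 k0 != 0 -> dotv (intv R u) d = 0 -> (forall j, dotv (a j) d < 0) ->
  exists2 v, idot u v = idot u z & forall j, dotv (a j) (intv R v) < b j.
Proof.
move=> uk0 ud ad.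
(* These integer vectors span the kernel of [dotv (intv R u)]. *)
pose W l : 'rV[int]_n := u 0 k0 *: delta_mx 0 l - u 0 l *: delta_mx 0 k0.
have uW l : idot u (W l) = 0.
  apply: (@intr_inj R); rewrite -dotv_intv.
  have -> : intv R (W l) = (u 0 k0)%:~R *: delta_mx 0 l - (u 0 l)%:~R *: delta_mx 0 k0.
    by apply/rowP => k; rewrite !mxE rmorphB !rmorphM !rmorph_nat.
  by rewrite dotvBr !dotvZr !dotv_delta !mxE mulrC subrr.
have ur0 : (u 0 k0)%:~R != 0 :> R by rewrite intr_eq0.
have dE lam : lam *: d = \sum_l (lam * d 0 l / (u 0 k0)%:~R) *: intv R (W l).
  apply/rowP => k; rewrite mxE summxE.
  under eq_bigr => l _ do rewrite !mxE eqxx /= rmorphB !rmorphM !rmorph_nat.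
  have ud' : \sum_l d 0 l * (u 0 l)%:~R = 0 :> R.
    by rewrite -[RHS]ud; apply: eq_bigr => l _; rewrite mxE mulrC.
  transitivity (lam * d 0 k - lam / (u 0 k0)%:~R * (k == k0)%:R *
      \sum_l d 0 l * (u 0 l)%:~R); first by rewrite ud' mulr0 subr0.
  rewrite mulr_sumr -sumrN.
  have F (x y e e' w w' : R) : w != 0 ->
      x * y * e' - x / w * e * (y * w') = x * y / w * (w * e' - w' * e).
    by move=> w0; field.
  rewrite (bigD1 k)//= [in RHS](bigD1 k)//= addrA; congr (_ + _).
    by rewrite -F// eqxx mulr1.
  apply: eq_bigr => l lk; rewrite [k == l]eq_sym (negbTE lk) -F//.
  by rewrite mulr0 add0r.
(* The sum bounds the rounding error, each coefficient being off by at most 1. *)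
pose C j := dotv (a j) (intv R z) + \sum_l `|dotv (a j) (intv R (W l))|.
have [t tP] := finite_bound (fun j => (b j - C j) / dotv (a j) d).
pose q l := Num.floor ((t + 1) * d 0 l / (u 0 k0)%:~R).
pose v := z + \sum_l q l *: W l.
exists v => [|j].
  rewrite /v idotDr; suff -> : idot u (\sum_l q l *: W l) = 0 by rewrite addr0.
  elim/big_ind : _ => [|x y x0 y0|l _].
  - by rewrite /idot big1// => k _; rewrite mxE mulr0.
  - by rewrite idotDr x0 y0.
  - transitivity (q l * idot u (W l)); last by rewrite uW mulr0.
    by rewrite mulr_sumr; apply: eq_bigr => k _; rewrite mxE mulrCA.
have vE : intv R v = intv R z + \sum_l (q l)%:~R *: intv R (W l).
  rewrite intvD; congr (_ + _); apply/rowP => k; rewrite mxE !summxE rmorph_sum.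
  by apply: eq_bigr => l _; rewrite !mxE rmorphM.
have tj : (t + 1) * dotv (a j) d < b j - C j.
  have := tP j; rewrite ler_ndivrMr// => H; have := ad j; lra.
suff : dotv (a j) (intv R v) <= C j + (t + 1) * dotv (a j) d by lra.
rewrite vE dotvDr -addrA lerD2l -dotvZr dE !dotv_sumr -big_split.
apply: ler_sum => l _ /=; rewrite !dotvZr.
have := ge_floor ((t + 1) * d 0 l / (u 0 k0)%:~R).
have := floorD1_gt ((t + 1) * d 0 l / (u 0 k0)%:~R); rewrite -/(q l) intrD.
set x := dotv _ (intv R (W l)); have := ler_norm x; have := ler_norm (- x).
rewrite normrN; nra.
Qed.

(** * Lattice-free polyhedra obtained by adding one halfspace *)

Section Covering.
Variables (R : realType) (n : nat).
Implicit Types (f x y : 'rV[R]_n) (B L : set 'rV[R]_n).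

Lemma Lfam_cons i q (a : 'I_q -> 'rV[R]_n) (b : 'I_q -> R) a0 (b0 : R) f :
  (q < i)%N -> (forall j, dotv (a j) f < b j) -> dotv a0 f < b0 ->
  (forall v, dotv a0 (intv R v) < b0 -> exists j, b j <= dotv (a j) (intv R v)) ->
  let B := [set x | dotv a0 x <= b0 /\ forall j, dotv (a j) x <= b j] in
  Lfam i B /\ B° f.
Proof.
move=> qi af a0f av B.
pose a' j := oapp a a0 (unlift ord0 j); pose b' j := oapp b b0 (unlift ord0 j).
have lE j : unlift ord0 (lift ord0 j : 'I_q.+1) = Some j by rewrite liftK.
have l0 : unlift ord0 (ord0 : 'I_q.+1) = None by rewrite unlift_none.
have -> : B = [set x | forall j, dotv (a' j) x <= b' j].
  apply/seteqP; split=> x /= => [[x0 xj] j|H].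
    by rewrite /a' /b'; case: (unliftP ord0 j) => [j' _|_] /=.
  split=> [|j]; first by have := H ord0; rewrite /a' /b' l0.
  by have := H (lift ord0 j); rewrite /a' /b' lE.
have af' j : dotv (a' j) f < b' j by rewrite /a' /b'; case: (unliftP ord0 j) => [j' _|_] /=.
split; last exact: strict_interior.
apply: (system_Lfam (f := f)) => // v.
have [a0v|a0v] := ltP (dotv a0 (intv R v)) b0.
  by have [j] := av v a0v; exists (lift ord0 j); rewrite /a' /b' lE.
by exists ord0; rewrite /a' /b' l0.
Qed.

Lemma intN_between (z : int) (t : R) (c : int) : `|z%:~R - c%:~R| < 1 :> R -> z = c.
Proof. by rewrite -intrB -intr_norm -[1]/(1%:~R) ltr_int; lia. Qed.

(* The case of a nonnegative slope [kappa].  If [kappa * (1 - tau) >= 1], the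
   system lies below the level [1] and one halfspace above the level [-1]
   suffices.  Otherwise tilting the system with slope 3 makes it shrink so fast
   below the level [0] that it is lattice-free there. *)
Lemma cover_nonneg_slope i q (a : 'I_q -> 'rV[R]_n) (b : 'I_q -> R) f
    (u : 'rV[int]_n) (mu : int) (kappa : R) (K : set 'rV[R]_n) :
  let g x := dotv (intv R u) x - mu%:~R in
  (q < i)%N -> (forall j, dotv (a j) f < b j) ->
  (forall v, idot u v = mu -> exists j, b j <= dotv (a j) (intv R v)) ->
  0 <= kappa ->
  (forall d, exists j, kappa * (b j - dotv (a j) f) * dotv (intv R u) d <= dotv (a j) d) ->
  K f ->
  (forall x, K x -> `|g x| <= 4^-1 /\ forall j, dotv (a j) (x - f) *+ 4 <= b j - dotv (a j) f) ->
  exists2 B, Lfam i B & B° f /\ K `<=` B.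
Proof.
move=> g qi af lev k0 slope Kf KP.
have gf : `|g f| <= 4^-1 by have [] := KP f Kf.
have gv v : g (intv R v) = (idot u v)%:~R - mu%:~R by rewrite /g dotv_intv.
have gx x : dotv (intv R u) x = g x + mu%:~R by rewrite /g; lra.
have beta0 j : 0 < b j - dotv (a j) f by rewrite subr_gt0.
have slopeg x : exists j, kappa * (b j - dotv (a j) f) * (g x - g f) <= dotv (a j) x - dotv (a j) f.
  by have [j] := slope (x - f); rewrite !dotvBr !gx => H; exists j; lra.
move: gf; rewrite ler_norml => /andP[gf1 gf2].
have [kA|kB] := leP 1 (kappa * (1 - g f)).
  have [|v gv1|H1 H2] := @Lfam_cons i q a b (- intv R u) (1 - mu%:~R) f qi af.
  - by rewrite dotvNl gx; lra.
  - apply/not_existsP => H.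
    have {}H j : dotv (a j) (intv R v) < b j by rewrite ltNge; apply/negP/H.
    have [|j] := lev v; last by rewrite leNgt H.
    apply: (@intN_between _ 0); rewrite -gv ltr_norml; apply/andP; split.
      by move: gv1; rewrite dotvNl gx; lra.
    have [j sj] := slopeg (intv R v); rewrite ltNge; apply/negP => g1.
    have : kappa * (g (intv R v) - g f) * (b j - dotv (a j) f) < 1 * (b j - dotv (a j) f).
      by have := H j; lra.
    rewrite ltr_pM2r// ltNge => /negP; apply.
    by apply: le_trans kA _; rewrite ler_wpM2l//; lra.
  - exists [set x | dotv (- intv R u) x <= 1 - mu%:~R /\ forall j, dotv (a j) x <= b j] => //.
    split=> // x Kx; have [] := KP x Kx; rewrite ler_norml => /andP[g1 g2] xP.
    split=> [|j]; first by rewrite dotvNl gx; lra.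
    by have := xP j; have := beta0 j; rewrite dotvBr -mulr_natr; lra.
(* The tilt fixes the inequalities on the level 0. With slope 3, points where [g] is at least [-1/4]
   keep [1 - 3/4 = 1/4] of the slack at [f], exactly the share that [K] may use. *)
pose a' j := a j - (3 * (b j - dotv (a j) f)) *: intv R u.
pose b' j := b j - 3 * (b j - dotv (a j) f) * mu%:~R.
have a'b' j x : b' j - dotv (a' j) x =
    (b j - dotv (a j) f) * (1 + 3 * g x) - (dotv (a j) x - dotv (a j) f).
  by rewrite /a' /b' dotvDl dotvNl dotvZl gx; ring.
have [j||v gv1|H1 H2] := @Lfam_cons i q a' b' (intv R u) (1 + mu%:~R) f qi.
- rewrite -subr_gt0 a'b' subrr subr0 mulr_gt0//; lra.
- by rewrite gx; lra.
- apply/not_existsP => H.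
  have {}H j : 0 < b' j - dotv (a' j) (intv R v) by rewrite subr_gt0 ltNge; apply/negP/H.
  have {}gv1 : g (intv R v) < 1 by move: gv1; rewrite gx; lra.
  have [g0|g0] := eqVneq (g (intv R v)) 0.
    have [|j] := lev v.
      by apply: (@intN_between _ 0); rewrite -gv g0 normr0.
    by have := H j; rewrite a'b' g0; lra.
  have gm1 : g (intv R v) <= -1.
    by move: gv1 g0; rewrite gv -intrB -(mulrN1z 1) -[X in _ < X]/(1%:~R) ltr_int ler_int intr_eq0; lia.
  have [j] := slopeg (intv R v); have := H j; rewrite a'b' => Hj sj.
  have : kappa * (g (intv R v) - g f) * (b j - dotv (a j) f) <
      (1 + 3 * g (intv R v)) * (b j - dotv (a j) f) by lra.
  rewrite ltr_pM2r// => Hk.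
  (* With [G] for the level of [v], these bounds give [G - g f < (1 - g f) * (1 + 3 * G)],
     impossible for [G <= -1] and [g f] within [1/4] of 0. *)
  have : (g (intv R v) - g f) * 1 <= (g (intv R v) - g f) * (kappa * (1 - g f)).
    by rewrite ler_wnM2l ?ltW//; lra.
  have : (1 - g f) * (kappa * (g (intv R v) - g f)) < (1 - g f) * (1 + 3 * g (intv R v)).
    by rewrite ltr_pM2l//; lra.
  nra.
- exists [set x | dotv (intv R u) x <= 1 + mu%:~R /\ forall j, dotv (a' j) x <= b' j] => //.
  split=> // x Kx; have [] := KP x Kx; rewrite ler_norml => /andP[g1 g2] xP.
  split=> [|j]; first by rewrite gx; lra.
  rewrite -subr_ge0 a'b'; have := xP j; rewrite dotvBr -mulr_natr.
  have := beta0 j; nra.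
Qed.

End Covering.

(** Reduces to a nonnegative slope, after replacing [u] by [- u] if necessary. *)
Lemma cover_level (R : realType) n i p (a : 'I_p -> 'rV[R]_n.+1) (b : 'I_p -> R) f
    (u : 'rV[int]_n.+1) k0 (mu : int) (K : set 'rV[R]_n.+1) :
  ~~ (2 %| u 0%R k0)%Z -> (2 ^ n < i)%N -> (forall j, dotv (a j) f < b j) ->
  (forall v, exists j, b j <= dotv (a j) (intv R v)) ->
  K f ->
  (forall x, K x -> `|dotv (intv R u) x - mu%:~R| <= 4^-1 /\
    forall j, dotv (a j) (x - f) *+ 4 <= b j - dotv (a j) f) ->
  exists2 B, Lfam i B & B° f /\ K `<=` B.
Proof.
move=> uk0 ni af av Kf KP.
have [q [s [qn lev]]] := doignon (c := mu) uk0 (fun v _ => av v).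
have uk1 : u 0 k0 != 0 by apply: contra uk0 => /eqP ->.
(* [u] need not be primitive, so the level [mu] may miss the lattice; then the slab between the
   levels [mu - 1] and [mu + 1] covers [K]. *)
have [[z zmu]|nz] := pselect (exists z, idot u z = mu); last first.
  have [gf _] := KP f Kf; move: gf; rewrite ler_norml => /andP[gf1 gf2].
  have [|j||v gv1|H1 H2] := @Lfam_cons R n.+1 i 1 (fun=> intv R u) (fun=> 1 + mu%:~R)
      (- intv R u) (1 - mu%:~R) f.
  - by apply: leq_trans ni; rewrite ltnS expn_gt0.
  - lra.
  - by rewrite dotvNl; lra.
  - exists ord0; rewrite leNgt; apply/negP => gv2; apply: nz; exists v.
    apply: (@intN_between R _ 0); rewrite ltr_norml.
    by move: gv1 gv2; rewrite dotvNl !dotv_intv; lra.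
  - eexists; first exact: H1; split=> // x Kx; have [] := KP x Kx.
    by rewrite ler_norml => /andP[g1 g2] _; split=> [|j]; rewrite ?dotvNl; lra.
have [|j|d ud|kappa slope] := @exists_slope R n.+1 q (intv R u)
    ((u 0 k0)%:~R^-1 *: delta_mx 0 k0) (a \o s) (fun j => b (s j) - dotv (a (s j)) f).
- by rewrite dotvZr dotv_delta mxE mulVf// intr_eq0.
- by rewrite subr_gt0.
(* A kernel direction decreasing all selected inequalities would round to a lattice point of the
   level satisfying them strictly. *)
- apply/not_existsP => H.
  have {}H j : dotv (a (s j)) d < 0 by rewrite ltNge; apply/negP/H.
  have [v uv vP] := hyperplane_rounding z (b \o s) uk1 ud H.
  have [|j] := lev v; first by rewrite uv.
  by rewrite leNgt vP.
have qi : (q < i)%N by apply: leq_ltn_trans ni.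
have [k0'|k0'] := leP 0 kappa.
  apply: (@cover_nonneg_slope R n.+1 i q (a \o s) (b \o s) f u mu kappa K) => // [j|x Kx].
    exact: af.
  by have [g1 xP] := KP x Kx; split=> // j; exact: xP.
have uN : intv R (- u) = - intv R u by apply/rowP => k; rewrite !mxE rmorphN.
apply: (@cover_nonneg_slope R n.+1 i q (a \o s) (b \o s) f (- u) (- mu) (- kappa) K) => //.
- by move=> j; exact: af.
- move=> v uv; apply: lev; apply: oppr_inj; rewrite -uv.
  by rewrite /idot -sumrN; apply: eq_bigr => k _; rewrite mxE mulNr.
- by rewrite oppr_ge0 ltW.
- by move=> d; have [j /= sj] := slope d; exists j => /=; rewrite uN dotvNl; lra.
- move=> x Kx; have [g1 xP] := KP x Kx; split=> [|j]; last exact: xP.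
  by rewrite uN dotvNl -normrN rmorphN opprB opprK addrC.
Qed.

(** * Gauge functions and bounds on [rho_f] *)

Section Gauge.
Variables (R : realType) (n : nat).
Implicit Types (f r : 'rV[R]_n) (B L : set 'rV[R]_n).

Lemma scale_translateP (l : R) B f r : 0 < l ->
  scale_set l (translate B f) r <-> B (f + l^-1 *: r).
Proof.
move=> l0; split=> [[_ [x Bx <-] <-]|BP].
  by rewrite scalerA mulVf ?gt_eqF// scale1r addrC subrK.
exists (l^-1 *: r); last by rewrite scalerA mulfV ?gt_eqF// scale1r.
by exists (f + l^-1 *: r) => //; rewrite addrC addKr.
Qed.

Lemma gauge_le B f r (l : R) :
  0 < l -> B (f + l^-1 *: r) -> gauge (translate B f) r <= l.
Proof.
move=> l0 Bl; apply: ge_inf; first by exists 0 => t [/ltW].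
by split=> //; apply/scale_translateP.
Qed.

(** Interiority of [f] makes the set of factors nonempty; the infimum of the empty set would be the
    default 0. *)
Lemma le_gauge B f r (c : R) : B° f ->
  (forall l, 0 < l -> B (f + l^-1 *: r) -> c <= l) -> c <= gauge (translate B f) r.
Proof.
move=> Bf H; apply: lb_le_inf => [|l [l0 /scale_translateP]]; last by move=> /(_ l0); exact: H.
have [t t0 Bt] := interior_ray r Bf; exists t^-1; split; first by rewrite invr_gt0.
by apply/scale_translateP; rewrite ?invr_gt0// invrK.
Qed.

Lemma gauge_ge0 B f r : B° f -> 0 <= gauge (translate B f) r.
Proof. by move=> Bf; apply: le_gauge => // l /ltW. Qed.

(* [F] must be nonempty: [CFam r f set0] also contains vectors with negative entries. *)
Lemma rho_f_le (F G : set (set 'rV[R]_n)) f (alpha : R) : 0 < alpha -> F !=set0 ->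
  (forall L, G L -> L° f -> exists2 B, F B &
     B° f /\ forall y, L y -> B (f + alpha^-1 *: (y - f))) ->
  (rho_f F G f <= alpha%:E)%E.
Proof.
move=> a0 [B0 FB0] H; apply: ereal_inf_lbound; exists alpha => //; split=> // k r k1 s sF.
exists (alpha *: s); last by rewrite scalerA mulVf ?gt_eqF// scale1r.
have s0 j : 0 <= s 0 j by have := sF _ FB0; rewrite /CB; case: ifP => _ => [[s0 _]|s0]; apply: s0.
have as0 j : 0 <= (alpha *: s) 0 j by rewrite mxE mulr_ge0// ltW.
move=> L GL; rewrite /CB; case: asboolP => // Lf; split=> //.
have [B FB [Bf LB]] := H L GL Lf.
have := sF B FB; rewrite /CB asboolT//= => -[_ s1]; apply: le_trans s1 _.
apply: ler_sum => j _; rewrite mxE [alpha * _]mulrC -mulrA ler_wpM2l//.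
rewrite -ler_pdivrMl//; apply: le_gauge => // l l0 /LB.
rewrite [f + _ - f]addrC addKr scalerA -invfM => Bl.
by rewrite ler_pdivrMl//; apply: gauge_le => //; rewrite mulr_gt0.
Qed.

End Gauge.

(** Halving a nonzero vector with even entries decreases the sum of absolute values, so repeated
    halving ends at an odd entry. *)
Lemma odd_multiple n (v : 'rV[int]_n) : v != 0 ->
  exists (e : nat) (w : 'rV[int]_n) (k0 : 'I_n),
    v = e.+1%:Z *: w /\ ~~ (2 %| w 0%R k0)%Z.
Proof.
have [N] := ubnP (\sum_k absz (v 0%R k))%N; elim: N v => // N ih v vN v0.
have [/forallP ev|/forallPn[k0 k0P]] := boolP [forall k, (2 %| v 0%R k)%Z]; last first.
  by exists 0, v, k0; rewrite scale1r.
have [w vw] : exists w, v = 2%:Z *: w.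
  exists (\row_k ((v 0%R k %/ 2)%Z)); apply/rowP => k.
  by rewrite !mxE; move: (v 0 k) (ev k) => t; lia.
have [k1 k1P] : exists k, w 0 k != 0.
  apply/existsP; apply: contraT; rewrite negb_exists => /forallP H.
  case/eqP: v0; rewrite vw; apply/rowP => k; rewrite !mxE.
  by have /negPn/eqP -> := H k; rewrite mulr0.
have [||e [x [k0 [wx k0P]]]] := ih w.
- move: vN; rewrite ltnS; apply: leq_trans; rewrite vw (bigD1 k1)//= [X in (_ <= X)%N](bigD1 k1)//=.
  rewrite mxE -addSn leq_add//; first by move: (w 0 k1) k1P => t; lia.
  by apply: leq_sum => k _; rewrite mxE abszM leq_pmull.
- by apply: contra k1P => /eqP ->; rewrite mxE.
exists (e.*2.+1), x, k0; split=> //; rewrite vw wx scalerA; congr (_ *: _); lia.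
Qed.

(** * Lattice width and thin directions *)

Section Width.
Variables (R : realType) (n : nat).

(** This slab shows both that [Lfam i] is nonempty and that [Flt] is at least 1. *)
Lemma slab_Lfam i : (2 <= i)%N -> Lfam i
  [set x : 'rV[R]_n.+1 | dotv (- delta_mx 0 ord0) x <= 0 /\
     forall j : 'I_1, dotv (delta_mx 0 ord0) x <= 1].
Proof.
move=> i2; have [|j||v v0|H _] := @Lfam_cons R n.+1 i 1 (fun=> delta_mx 0 ord0) (fun=> 1)
  (- delta_mx 0 ord0) 0 (2^-1 *: delta_mx 0 ord0) => //.
- by rewrite dotvZr dotv_delta mxE !eqxx /=; lra.
- by rewrite dotvNl dotvZr dotv_delta mxE !eqxx /=; lra.
- exists ord0; move: v0; rewrite dotvNl dotvC dotv_delta mxE oppr_lt0.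
  by rewrite ltr0z ler1z; lia.
Qed.

Lemma Flt_ge1 : (1%:E <= Flt R n.+1)%E.
Proof.
apply: ereal_sup_ge; eexists; first by eexists; first exact: (slab_Lfam (leqnn 2)).1.
apply: le_ereal_inf_tmp => _ [u [ul u0] <-].
have /existsP[k uk] : [exists k, u 0 k != 0].
  apply: contraR u0; rewrite negb_exists => /forallP H.
  by apply/eqP/rowP => k; rewrite mxE; apply/eqP/negPn.
set S := [set x | _].
have S0 : S 0 by split=> [|j]; rewrite (dotvC _ 0) dotv0l.
have Sk : S (delta_mx 0 k).
  by rewrite /S /= dotvNl dotv_delta mxE; case: (_ && _) => /=; split=> *; lra.
have [z uz] := intrP (ul k).
(* The slab contains 0 and the [k]-th unit vector, on which [dotv u] differs by the nonzero integer
   [u 0 k]. *)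
have W x y : S x -> S y -> ((dotv u x - dotv u y)%:E <=
    ereal_sup [set (dotv u x)%:E | x in S] - ereal_inf [set (dotv u x)%:E | x in S])%E.
  move=> Sx Sy; rewrite EFinB; apply: leeB.
    by apply: ereal_sup_ubound; exists x.
  by apply: ereal_inf_lbound; exists y.
move: uk; rewrite uz intr_eq0 => z0.
have [zp|zn] := leP 0 z.
  apply: le_trans (W _ _ Sk S0); rewrite lee_fin dotv_delta (dotvC _ 0) dotv0l subr0 uz.
  by rewrite ler1z; lia.
apply: le_trans (W _ _ S0 Sk); rewrite lee_fin dotv_delta (dotvC _ 0) dotv0l sub0r uz.
by rewrite -rmorphN ler1z; lia.
Qed.

(** A direction of width below [c] is a positive integer multiple of one with an odd entry, whose
    width is no larger. *)
Lemma exists_thin_direction (L : set 'rV[R]_n.+1) (c : R) :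
  lattice_free L -> (Flt R n.+1 < c%:E)%E ->
  exists (u : 'rV[int]_n.+1) k0, ~~ (2 %| u 0%R k0)%Z /\
    forall x y, L x -> L y -> dotv (intv R u) x - dotv (intv R u) y <= c.
Proof.
move=> Lf Fc.
have /ereal_inf_lt[_ [u0 [u0l u0n] <-] uc] : (lattice_width L < c%:E)%E.
  by apply: le_lt_trans Fc; apply: ereal_sup_ubound; exists L.
have [v uv] := (lattice_ptP _).1 u0l.
have [|e [u [k0 [vu uk0]]]] := @odd_multiple _ v.
  by apply: contra u0n => /eqP v0; rewrite uv v0; apply/eqP/rowP => k; rewrite !mxE.
have vE x : dotv u0 x = e.+1%:R * dotv (intv R u) x.
  by rewrite uv vu -dotvZl; congr dotv; apply/rowP => k; rewrite !mxE rmorphM.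
have W x y : L x -> L y -> dotv u0 x - dotv u0 y <= c.
  move=> Lx Ly; rewrite -lee_fin EFinB; apply: le_trans (ltW uc); apply: leeB.
    by apply: ereal_sup_ubound; exists x.
  by apply: ereal_inf_lbound; exists y.
exists u, k0; split=> // x y Lx Ly.
have c0 : 0 <= c by have := W x x Lx Lx; rewrite subrr.
have := W x y Lx Ly; rewrite !vE -mulrBr => H.
have [d0|d0] := leP (dotv (intv R u) x - dotv (intv R u) y) 0; first exact: le_trans c0.
apply: le_trans H; apply: ler_peMl; [exact: ltW | by rewrite ler1n].
Qed.

End Width.

Lemma Lfam_approximates (R : realType) n i (L : set 'rV[R]_n.+1) f (alpha : R) :
  (2 ^ n < i)%N -> Lstar L -> L° f -> (4%:E * Flt R n.+1 < alpha%:E)%E ->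
  exists2 B, Lfam i B & B° f /\ forall y, L y -> B (f + alpha^-1 *: (y - f)).
Proof.
move=> ni [Llf [m Lm]] Lf Fa.
have Fa4 : (Flt R n.+1 < (alpha / 4)%:E)%E.
  move: Fa; case: (Flt R n.+1) => [F||]; rewrite ?ltNyr//.
    by rewrite -EFinM !lte_fin; lra.
  by rewrite gt0_muley.
(* This makes [K] use at most a quarter of each slack at [f]. *)
have a4 : 4 <= alpha.
  have := le_lt_trans (Flt_ge1 R n) Fa4; rewrite lte_fin; lra.
have a0 : 0 < alpha by lra.
have [u [k0 [uk0 uL]]] := exists_thin_direction Llf Fa4.
have [a [b [LE af]]] := poly_strict Lm Lf.
have av v : exists j, b j <= dotv (a j) (intv R v).
  by apply: lattice_free_system; rewrite -LE.
pose K := [set f + alpha^-1 *: (y - f) | y in L].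
suff [B FB [Bf KB]] : exists2 B, Lfam i B & B° f /\ K `<=` B.
  by exists B => //; split=> // y Ly; apply: KB; exists y.
have Kf : K f.
  by exists f; [exact: interior_subset | rewrite subrr scaler0 addr0].
have Ka x j : K x -> dotv (a j) (x - f) *+ 4 <= b j - dotv (a j) f.
  move=> [y Ly <-]; rewrite addrAC subrr add0r dotvZr dotvBr -mulr_natr -mulrA.
  have yb : dotv (a j) y <= b j by move: Ly; rewrite LE; apply.
  have := af j => fb; rewrite ler_pdivrMl//; nra.
have Ku x y : K x -> K y -> dotv (intv R u) x - dotv (intv R u) y <= 4^-1.
  move=> [x' Lx <-] [y' Ly <-]; rewrite -dotvBr opprD addrACA subrr add0r -scalerBr.
  rewrite opprB addrA subrK dotvZr dotvBr ler_pdivrMl//.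
  by have := uL _ _ Lx Ly; lra.
set mu := Num.floor (dotv (intv R u) f).
have fmu := ge_floor (dotv (intv R u) f); have := floorD1_gt (dotv (intv R u) f).
rewrite -/mu intrD in fmu * => fmu1.
(* [f] is on or above this level and [x] on or below it, so the width bound puts all of [K] within
   [1/4] of the level. *)
have [[x [Kx xmu]]|H1] := pselect (exists x, K x /\ dotv (intv R u) x <= mu%:~R).
  apply: (cover_level (mu := mu) uk0 ni af av Kf) => y Ky; split=> [|j]; last exact: Ka.
  by have := Ku _ _ Ky Kx; have := Ku _ _ Kf Ky; rewrite ler_norml; lra.
have [[x [Kx xmu]]|H2] := pselect (exists x, K x /\ mu%:~R + 1 <= dotv (intv R u) x).
  apply: (cover_level (mu := mu + 1) uk0 ni af av Kf) => y Ky; split=> [|j]; last exact: Ka.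
  by have := Ku _ _ Kx Ky; have := Ku _ _ Ky Kf; rewrite intrD ler_norml; lra.
have lo x : K x -> mu%:~R < dotv (intv R u) x.
  by move=> Kx; rewrite ltNge; apply/negP => ?; apply: H1; exists x.
have up x : K x -> dotv (intv R u) x < mu%:~R + 1.
  by move=> Kx; rewrite ltNge; apply/negP => ?; apply: H2; exists x.
have [|j||v gv1|H3 H4] := @Lfam_cons R n.+1 i 1 (fun=> intv R u) (fun=> mu%:~R + 1)
    (- intv R u) (- mu%:~R) f.
- by apply: leq_trans ni; rewrite ltnS expn_gt0.
- exact: up.
- by rewrite dotvNl ltrN2; exact: lo.
- exists ord0; move: gv1; rewrite dotvNl ltrN2 dotv_intv -intrD1 ltr_int ler_int; lia.
- eexists; first exact: H3; split=> // x Kx.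
  by split=> [|j]; [rewrite dotvNl lerN2 ltW// lo | rewrite ltW// up].
Qed.

Lemma rho_le_4Flt (R : realType) n i : (2 ^ n < i)%N ->
  (rho (@Lfam R n.+1 i) (@Lstar R n.+1) <= 4%:E * Flt R n.+1)%E.
Proof.
move=> ni; apply: ge_ereal_sup => _ [f _ <-].
have H (alpha : R) : (4%:E * Flt R n.+1 < alpha%:E)%E ->
    (rho_f (@Lfam R n.+1 i) (@Lstar R n.+1) f <= alpha%:E)%E.
  move=> Fa; apply: rho_f_le => [||L LL Lf]; last exact: Lfam_approximates; last first.
    by eexists; apply: slab_Lfam; apply: leq_trans ni; rewrite ltnS expn_gt0.
  rewrite -lte_fin; apply: le_lt_trans Fa; apply: mule_ge0; first by rewrite lee_fin.
  by apply: le_trans (Flt_ge1 R n); rewrite lee_fin.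
move: H (Flt_ge1 R n); case: (Flt R n.+1) => [F||] H F1 //.
  by apply/lee_addgt0Pr => e e0; rewrite -EFinM -EFinD; apply: H; rewrite -EFinM lte_fin ltrDl.
by rewrite gt0_muley ?leey// lte_fin.
Qed.

(** * The lower bound *)

Section LowerBound.
Variables (R : realType) (n : nat).
Implicit Types (f : 'rV[R]_n) (B L : set 'rV[R]_n).

(* With [i] halfspaces and [i.+1] lattice points, one halfspace cuts off two of
   them, hence the whole segment between them. *)
Lemma segment_gauge i B f (p : 'I_i.+1 -> 'rV[int]_n) : Lfam i B -> B° f ->
  exists j l : 'I_i.+1, (j < l)%N /\ forall t : R, 0 <= t -> t <= 1 ->
    1 <= gauge (translate B f) ((1 - t) *: intv R (p j) + t *: intv R (p l) - f).
Proof.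
move=> [Blf Bi] Bf; have [a [b [BE af]]] := poly_strict Bi Bf.
have /choice[h hP] : forall e, exists j, b j <= dotv (a j) (intv R (p e)).
  by move=> e; apply: lattice_free_system; rewrite -BE.
have [e [e' ee' he]] : exists e, exists2 e', e != e' & h e = h e'.
  apply/injectivePn/negP => /injectiveP /leq_card.
  by rewrite !card_ord ltnn.
have seg j l : h j = h l -> forall t : R, 0 <= t -> t <= 1 ->
    1 <= gauge (translate B f) ((1 - t) *: intv R (p j) + t *: intv R (p l) - f).
  move=> hjl t t0 t1; apply: le_gauge => // c c0.
  rewrite {1}BE => /(_ (h j)); rewrite dotvDr dotvZr dotvBr dotvDr !dotvZr => H.
  have Hj := hP j; have Hl := hP l; rewrite -hjl in Hl; have Hf := af (h j).
  move: H; rewrite -lerBrDl ler_pdivrMl// => H.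
  have : (b (h j) - dotv (a (h j)) f) * 1 <= (b (h j) - dotv (a (h j)) f) * c.
    by rewrite mulr1 [_ * c]mulrC; apply: le_trans H; nra.
  by rewrite ler_pM2l// subr_gt0.
case: (ltngtP e e') => [lt|lt|eq]; last by case/eqP: ee'; apply: val_inj.
- by exists e, e'; split=> //; apply: seg.
- by exists e', e; split=> //; apply: seg.
Qed.

(** The pair of large gauge depends on [B], so all pairs serve as rays at once, with the all-ones
    vector. For [L] each gauge is at most [M^-1]; the number of rays is the loss. *)
Lemma rho_f_ge i L f (p : 'I_i.+1 -> 'rV[int]_n)
    (x : 'I_i.+1 -> 'I_i.+1 -> 'rV[R]_n) (M : R) :
  Lfam i.+1 L -> L° f -> 0 < M ->
  (forall j l : 'I_i.+1, (j < l)%N -> exists t : R, [/\ 0 <= t, t <= 1 &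
     x j l = (1 - t) *: intv R (p j) + t *: intv R (p l)]) ->
  (forall j l, L (f + M *: (x j l - f))) ->
  ((M / (#|{: 'I_i.+1 * 'I_i.+1}|)%:R)%:E <= rho_f (Lfam i) (Lfam i.+1) f)%E.
Proof.
move=> LL Lf M0 xP xL; set k := #|_|.
have k0 : (0 < k)%N by rewrite /k card_prod card_ord muln_gt0.
apply: le_ereal_inf_tmp => _ [al [al0 alP] <-].
pose r (e : 'I_k) := let: (j, l) := enum_val e in x j l - f.
have rB B (e : 'I_k) : B° f -> 0 <= gauge (translate B f) (r e) by exact: gauge_ge0.
have : CFam r f (Lfam i) (const_mx 1).
  move=> B FB; rewrite /CB; case: asboolP => Bf => [|j]; last by rewrite mxE.
  split=> [j|]; first by rewrite mxE.
  have [j [l [jl H]]] := segment_gauge p FB Bf.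
  have [t [t0 t1 xE]] := xP j l jl.
  rewrite (bigD1 (enum_rank (j, l)))//= mxE mul1r {1}/r enum_rankK xE ler_wpDr ?H//.
  by apply: sumr_ge0 => e _; rewrite mxE mul1r rB.
move=> /(alP k r k0)[s sL sE].
have {}sE e : s 0 e = al.
  have := congr1 (fun A : 'rV_k => al * A 0 e) sE.
  by rewrite !mxE mulrA mulfV ?gt_eqF// mul1r mulr1.
have := sL L LL; rewrite /CB asboolT//= => -[_ s1].
rewrite lee_fin ler_pdivrMr ?ltr0n// -[M]mul1r -ler_pdivlMr//.
apply: le_trans s1 _; apply: (@le_trans _ _ (\sum_(e < k) al * M^-1)).
  apply: ler_sum => e _; rewrite sE; apply: ler_wpM2l; first exact: ltW.
  apply: gauge_le; rewrite ?invr_gt0// invrK /r; case: (enum_val e) => j l; exact: xL.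
by rewrite sumr_const card_ord mulrAC mulr_natr.
Qed.

End LowerBound.

(** [T j] encodes a subcube, [None] marking a free coordinate. The induction splits along the first
    coordinate and shares [i] evenly between the two halves. *)
Lemma cube_partition d i : (0 < i)%N -> (i <= 2 ^ d)%N ->
  exists T : 'I_i -> 'I_d -> option bool,
    (forall s : 'I_d -> bool, exists j, forall k c, T j k = Some c -> c = s k) /\
    (forall j l, j != l -> exists k c, T j k = Some c /\ T l k = Some (~~ c)).
Proof.
elim: d i => [|d ih] i i0 i2.
  have -> : i = 1%N by move: i0 i2; rewrite expn0; lia.
  by exists (fun _ _ => None); split=> [s|j l]; [exists ord0 | rewrite !ord1].
have [i1|i1] := leqP i 1.
  have -> : i = 1%N by lia.
  by exists (fun _ _ => None); split=> [s|j l]; [exists ord0 | rewrite !ord1].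
have [m [p [-> m0 p0 m2 p2]]] : exists m p,
    [/\ i = m + p, 0 < m, 0 < p, m <= 2 ^ d & p <= 2 ^ d]%N.
  by exists i./2, (i - i./2)%N; move: i2; rewrite expnS; split; lia.
have [T1 [c1 d1]] := ih m m0 m2; have [T2 [c2 d2]] := ih p p0 p2.
pose T (j : 'I_(m + p)) (k : 'I_d.+1) := match unlift ord0 k, fintype.split j with
  | None, inl _ => Some true | None, inr _ => Some false
  | Some k', inl j' => T1 j' k' | Some k', inr j' => T2 j' k' end.
have TE b k : T (unsplit b) k = match unlift ord0 k, b with
  | None, inl _ => Some true | None, inr _ => Some false
  | Some k', inl j' => T1 j' k' | Some k', inr j' => T2 j' k' end.
  by rewrite /T unsplitK.
exists T; split=> [s|j l].
  have [s0|s0] := boolP (s ord0).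
    have [j jP] := c1 (s \o lift ord0); exists (unsplit (inl j)) => k c; rewrite TE.
    by case: unliftP => [k' ->|-> [<-]]; [exact: jP | rewrite s0].
  have [j jP] := c2 (s \o lift ord0); exists (unsplit (inr j)) => k c; rewrite TE.
  by case: unliftP => [k' ->|-> [<-]]; [exact: jP | rewrite (negbTE s0)].
rewrite -[j]splitK -[l]splitK; case: (fintype.split j) => j'; case: (fintype.split l) => l' jl.
- have [|k [c [? ?]]] := d1 j' l'; first by apply: contra jl => /eqP ->.
  by exists (lift ord0 k), c; rewrite !TE liftK.
- by exists ord0, true; rewrite !TE unlift_none.
- by exists ord0, false; rewrite !TE unlift_none.
- have [|k [c [? ?]]] := d2 j' l'; first by apply: contra jl => /eqP ->.
  by exists (lift ord0 k), c; rewrite !TE liftK.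
Qed.

(* The distance from the coordinate [y] to the bounding hyperplane of a subcube of
   [{0,1}^d] whose constraint on that coordinate is [o]. *)
Definition coord_slack (R : realType) (o : option bool) (y : R) : R :=
  match o with None => 0 | Some true => 1 - y | Some false => y end.

(** Serves for vectors, with the height first, and for families of lattice points, with the one of
    level [-1] first. *)
Definition ord_cons (X : Type) d (x0 : X) (x : 'I_d -> X) (k : 'I_d.+1) : X :=
  oapp x x0 (unlift ord0 k).

Lemma ord_cons0 (X : Type) d (x0 : X) (x : 'I_d -> X) : ord_cons x0 x ord0 = x0.
Proof. by rewrite /ord_cons unlift_none. Qed.

Lemma ord_consS (X : Type) d (x0 : X) (x : 'I_d -> X) k :
  ord_cons x0 x (lift ord0 k) = x k.
Proof. by rewrite /ord_cons liftK. Qed.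

(* The cross-section of the pyramid [L] at height 0 has one facet for each subcube
   of the partition; its apex is at height [kap] and [f] lies just below it. *)
Lemma bad_pyramid (R : realType) d i (M : R) : (2 <= i)%N -> (i <= 2 ^ d)%N -> 1 <= M ->
  exists (L : set 'rV[R]_d.+1) f (p : 'I_i.+1 -> 'rV[int]_d.+1)
    (x : 'I_i.+1 -> 'I_i.+1 -> 'rV[R]_d.+1),
  [/\ ~ lattice_pt f, Lfam i.+1 L, L° f,
    forall j l : 'I_i.+1, (j < l)%N -> exists t : R, [/\ 0 <= t, t <= 1 &
      x j l = (1 - t) *: intv R (p j) + t *: intv R (p l)] &
    forall j l, L (f + M *: (x j l - f))].
Proof.
move=> i2 id M1; have [T [cov disj]] := cube_partition (ltnW i2) id.
pose h := @coord_slack R.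
pose bt j := \sum_k h (T j k) 2^-1.
(* [bt j] is the slack of facet [j] at the centre of the cube. The height [eta] of [f] is chosen so
   that [f] has slack [bt j * nu], at most [1/2]. *)
pose kap : R := (2 * M)^-1; pose nu : R := d.+2%:R^-1; pose eta := kap * (1 - nu).
have Mkap : M * kap = 2^-1 by rewrite /kap; field; lra.
have kap0 : 0 < kap by rewrite invr_gt0; lra.
have kap1 : kap <= 2^-1 by nra.
have nu0 : 0 < nu by rewrite invr_gt0.
have nu1 : nu < 1 by rewrite invf_lt1// ltr1n.
have eta0 : 0 < eta by rewrite mulr_gt0// subr_gt0.
have eta1 : eta <= kap by rewrite /eta; nra.
have h0 o : 0 <= h o 0 /\ 0 <= h o 2^-1 <= 2^-1 by case: o => [[]|] /=; lra.
have bt0 j : 0 < bt j.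
  (* A second subcube exists since [2 <= i], so subcube [j] has a fixed coordinate. *)
  have [l lj] : exists l : 'I_i, l != j.
    have lt1 : ((j == 0 :> nat) < i)%N by case: (_ == _); lia.
    by exists (Ordinal lt1); rewrite -val_eqE /=; case: (nat_of_ord j) => [|[]].
  have [k [c [_ jk]]] := disj _ _ lj.
  rewrite /bt (bigD1 k)//= ltr_pwDl//; last by apply: sumr_ge0 => e _; have [_ /andP[]] := h0 (T j e).
  by rewrite jk; case: c {jk} => /=; lra.
have btnu j : bt j * nu <= 2^-1.
  have : bt j <= \sum_(k < d) 2^-1 by apply: ler_sum => k _; have [_ /andP[]] := h0 (T j k).
  rewrite sumr_const card_ord -[_ *+ d]mulr_natr => H.
  rewrite ler_pdivrMr ?ltr0n//; apply: le_trans H _.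
  by rewrite ler_pM2l ?invr_gt0// ler_nat; lia.
pose t j k : R := h (T j k) 0 - h (T j k) 1.
pose a j : 'rV[R]_d.+1 := \row_k ord_cons (bt j / kap) (t j) k.
pose b j := \sum_k h (T j k) 0.
have slE j x : b j - dotv (a j) x =
    \sum_k h (T j k) (x 0 (lift ord0 k)) - bt j / kap * x 0 ord0.
  rewrite /dotv big_ord_recl /= mxE ord_cons0 opprD addrCA addrC; congr (_ - _).
  rewrite /b -sumrB; apply: eq_bigr => k _; rewrite mxE ord_consS /t.
  by case: (T j k) => [[]|] /=; lra.
pose f : 'rV[R]_d.+1 := \row_k ord_cons eta (fun=> 2^-1) k.
have slf j : b j - dotv (a j) f = bt j * nu.
  rewrite slE mxE ord_cons0 /bt; under eq_bigr do rewrite mxE ord_consS.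
  by rewrite -/(bt j) /eta; field; lra.
pose z j : 'rV[int]_d.+1 := \row_k ord_cons 0 (fun k => (T j k == Some true)%:R) k.
have slz j l : 0 <= b j - dotv (a j) (intv R (z l)) /\
    (j != l -> 1 <= b j - dotv (a j) (intv R (z l))).
  have H k : 0 <= h (T j k) (intv R (z l) 0 (lift ord0 k)).
    by rewrite !mxE ord_consS; case: (T j k) (T l k) => [[]|] [[]|] /=; lra.
  have z0 : intv R (z l) 0 ord0 = 0 by rewrite !mxE ord_cons0.
  rewrite slE z0 mulr0 subr0; split=> [|jl]; first exact: sumr_ge0.
  have [k [c [jk lk]]] := disj _ _ jl.
  rewrite (bigD1 k)//= ler_wpDr ?sumr_ge0// !mxE ord_consS jk lk.
  by case: c {jk lk} => /=; lra.
pose w : 'rV[int]_d.+1 := \row_k ord_cons (-1) (fun=> 0) k.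
have slw j : bt j / kap <= b j - dotv (a j) (intv R w).
  rewrite slE !mxE ord_cons0 rmorphN mulrN mulr1 opprK ler_wpDl//.
  by apply: sumr_ge0 => k _; rewrite !mxE ord_consS; have [] := h0 (T j k).
pose p := ord_cons w z.
(* Weight [kap] on [w] gives height [- kap] and slack at least [bt j]; the midpoint of two contact
   points has slack at least [1/2]. *)
pose t0 (e : 'I_i.+1) : R := ord_cons (1 - kap) (fun=> 2^-1) e.
have t01 e : 0 <= t0 e <= 1.
  rewrite /t0; case: (unliftP ord0 e) => [k ->|->]; rewrite ?ord_consS ?ord_cons0;
    clear -kap0 kap1; lra.
(* Other pairs get the dummy [f], fixed by the dilation. *)
pose x (e e' : 'I_i.+1) : 'rV[R]_d.+1 := if (e < e')%N
  then (1 - t0 e) *: intv R (p e) + t0 e *: intv R (p e') else f.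
have [j||v v0|LL Lf] := @Lfam_cons R d.+1 i.+1 i a b (- delta_mx 0 ord0) 1 f (ltnSn i).
- by rewrite -subr_gt0 slf mulr_gt0.
- by rewrite dotvNl dotvC dotv_delta mxE ord_cons0; lra.
(* The signs of the coordinates select a subcube for which every term of the slack at [v] is
   nonpositive. *)
- have [j jP] := cov (fun k => 0 < v 0 (lift ord0 k)).
  have {}v0 : 0 <= v 0 ord0.
    move: v0; rewrite dotvNl dotvC dotv_delta mxE -rmorphN ltrz1; lia.
  exists j; rewrite -subr_le0 slE subr_le0.
  apply: (@le_trans _ _ 0).
    apply: sumr_le0 => k _; have := jP k; rewrite mxE; move: (v 0 _) => y.
    case: (T j k) => [c /(_ _ erefl)|//]; case: c => /= yP.
      by rewrite subr_le0 ler1z; lia.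
    by rewrite lerz0; lia.
  by apply: mulr_ge0; [rewrite divr_ge0 ?ltW | rewrite mxE ler0z].
exists [set x | dotv (- delta_mx 0 ord0) x <= 1 /\ forall j, dotv (a j) x <= b j], f, p, x.
split=> //.
- move=> /(_ ord0)/intrP[y]; rewrite mxE ord_cons0 => ye.
  have : (0 < y%:~R :> R) && (y%:~R < 1 :> R) by rewrite -ye; lra.
  by rewrite ltr0z ltrz1; lia.
- move=> e e' ee'; exists (t0 e); rewrite /x ee'.
  by have /andP[? ?] := t01 e; split.
- have affine j t' y y' : b j - dotv (a j) ((1 - t') *: y + t' *: y') =
      (1 - t') * (b j - dotv (a j) y) + t' * (b j - dotv (a j) y').
    by rewrite dotvDr !dotvZr; ring.
  move=> e e'; rewrite /x; case: ifP => [ee'|_]; last first.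
    by rewrite subrr scaler0 addr0; exact: interior_subset Lf.
  set y := (1 - t0 e) *: _ + _.
  have yE : f + M *: (y - f) = (1 - M) *: f + M *: y.
    by rewrite scalerBr scalerBl scale1r addrA addrAC.
  (* If [y] has at least the slack of [f], so does the dilated point; and [M * kap = 1/2] keeps its
     height at least [-1]. *)
  suff [y0 yj] : - kap <= y 0 ord0 /\ forall j, bt j * nu <= b j - dotv (a j) y.
    split=> [|j]; last by rewrite -subr_ge0 yE affine slf; have := yj j; have := bt0 j; nra.
    have -> : dotv (- delta_mx 0 ord0) (f + M *: (y - f)) =
        (M - 1) * eta - M * y 0 ord0.
      rewrite yE dotvNl dotvDr !dotvZr ![dotv (delta_mx _ _) _]dotvC !dotv_delta.
      by rewrite [f 0 ord0]mxE ord_cons0; ring.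
    have : M * eta <= M * kap by rewrite ler_pM2l//; lra.
    have : M * - kap <= M * y 0 ord0 by rewrite ler_pM2l//; lra.
    rewrite mulrN Mkap; lra.
  have [p0 pS] : p ord0 = w /\ forall j, p (lift ord0 j) = z j.
    by split=> [|j]; rewrite /p ?ord_cons0 ?ord_consS.
  have [t00 t0S] : t0 ord0 = 1 - kap /\ forall j, t0 (lift ord0 j) = 2^-1.
    by split=> [|j]; rewrite /t0 ?ord_cons0 ?ord_consS.
  have zz l : intv R (z l) 0 ord0 = 0 by rewrite !mxE ord_cons0.
  have ww : intv R w 0 ord0 = -1 by rewrite !mxE ord_cons0 rmorphN.
  move: ee'; rewrite /y; case: (unliftP ord0 e') => [l' ->|->]; last by rewrite ltn0.
  rewrite pS; case: (unliftP ord0 e) => [l ->|-> _].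
    rewrite !pS t0S => ll'; split=> [|j].
      by rewrite !mxE; move: (zz l) (zz l'); rewrite !mxE => -> ->; lra.
    rewrite affine; apply: le_trans (btnu j) _.
    have [sl1 sl2] := slz j l; have [sl1' sl2'] := slz j l'.
    have [jl|/sl2] := eqVneq j l; last by lra.
    have /sl2' : j != l' by rewrite jl; apply: contraTneq ll' => ->; rewrite ltnn.
    lra.
  rewrite p0 t00; split=> [|j].
    by rewrite !mxE; move: (zz l') ww; rewrite !mxE => -> ->; lra.
  rewrite affine; have [sl1 _] := slz j l'; have := slw j; rewrite ler_pdivrMr// => H.
  have := bt0 j; nra.
Qed.


Lemma rho_pinfty (R : realType) n i : (2 <= i)%N -> (i <= 2 ^ n)%N ->
  rho (@Lfam R n.+1 i) (@Lfam R n.+1 i.+1) = +oo%E.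
Proof.
move=> i2 id; apply/eqyP => A A0.
set k := #|{: 'I_i.+1 * 'I_i.+1}|.
have k1 : 1 <= k%:R :> R by rewrite ler1n /k card_prod card_ord muln_gt0.
(* The factor [k] offsets the number of rays in [rho_f_ge]. *)
have M1 : 1 <= (A + 1) * k%:R by nra.
have [L [f [p [x [fl LL Lf xP xL]]]]] := bad_pyramid i2 id M1.
have M0 : 0 < (A + 1) * k%:R by lra.
apply: le_trans (ereal_sup_ubound _); last by exists f; [exact: fl | reflexivity].
apply: le_trans (rho_f_ge LL Lf M0 xP xL).
by rewrite lee_fin -/k -mulrA mulfV ?mulr1; lra.
Qed.

Theorem theorem2p1 (R : realType) (n i : nat) :
  (2 <= i)%N -> (i <= 2 ^ n)%N ->
  ((i <= 2 ^ n.-1)%N -> rho (@Lfam R n i) (@Lfam R n i.+1) = +oo%E) /\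
  ((2 ^ n.-1 < i)%N -> (rho (@Lfam R n i) (@Lstar R n) <= 4%:E * Flt R n)%E).
Proof.
(* In dimension 0 the range [2 <= i <= 1] is empty. *)
case: n => [|n] i2 ile; first by have := leq_trans i2 ile.
by split=> [id|id]; [exact: rho_pinfty | exact: rho_le_4Flt].
Qed.
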